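(* (ABC Theorem) For every $n\in\mathbb N$ and nonzero complex $x,y$, the Christoffel--Darboux kernel $K^{[n]}(x,y)=A^{[n]}(x^{-1})B^{[n]}(y)$ satisfies $$K^{[n]}(x,y)=\big(Z_{[p]}^\top(x^{-1})\big)^{[n]}\,\big(M^{[n]}\big)^{-1}\,\big(Z_{[q]}(y)\big)^{[n]}.$$ Componentwise, for $a\in\{1,\dots,p\}$ and $b\in\{1,\dots,q\}$, $$K_{a,b}^{[n]}(x,y)=\Big(\big(Z_{[p]}^{(a)}(x^{-1})\big)^{[n]}\Big)^\top\big(M^{[n]}\big)^{-1}\big(Z_{[q]}^{(b)}(y)\big)^{[n]}.$$
   Context: Let $p,q\in\mathbb N$ and let $\mu$ be a $q\times p$ matrix of complex Borel measures with infinite support on the unit circle $\mathbb T=\{|z|=1\}$. Rows and columns of semi-infinite matrices are indexed from $0$. For $r\in\mathbb N$, $Z_{[r]}(z)$ is the $\infty\times r$ matrix obtained by stacking the $r\times r$ blocks $I_r, z^{-1}I_r, zI_r, z^{-2}I_r, z^2I_r,\dots$ (block number $2N$ is $z^NI_r$, block number $2N+1$ is $z^{-N-1}I_r$); $Z_{[r]}^{(j)}$ is its $j$-th column, $j=1,\dots,r$. The moment matrix is $M=\oint_{\mathbb T}Z_{[q]}(z)\,\mathrm d\mu(z)\,Z_{[p]}^\top(z^{-1})$. It is assumed that $M=L^{-1}U^{-1}$ with $L$ lower triangular and $U$ upper triangular semi-infinite matrices with nonzero diagonal entries. Put $B(z)=LZ_{[q]}(z)$ and $A(z^{-1})=Z_{[p]}^\top(z^{-1})U$.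 Truncations: $M^{[n]}$ is the leading $n\times n$ submatrix of $M$; $B^{[n]}$, $(Z_{[q]})^{[n]}$, $(Z^{(j)}_{[r]})^{[n]}$ denote the first $n$ rows; $A^{[n]}$ and $(Z_{[p]}^\top)^{[n]}$ denote the first $n$ columns. $K^{[n]}_{a,b}$ is the $(a,b)$ entry of the $p\times q$ matrix $K^{[n]}$. *)

(* Defs.v *)
From HB Require Import structures.
From mathcomp Require Import all_boot all_order all_algebra.
From mathcomp Require Import all_classical all_reals all_analysis.
From mathcomp Require Import complex.

Set Implicit Arguments.
Unset Strict Implicit.
Unset Printing Implicit Defensive.

Import Order.TTheory GRing.Theory Num.Theory.
Import numFieldNormedType.Exports.

Local Open Scope classical_set_scope.
Local Open Scope ring_scope.
Local Open Scope complex_scope.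

Section borel_circle.
Variable R : realType.

(* The topology of R[i] is only found by inference on R[i]^o. *)
Definition unit_circle : set (R[i]^o) := [set z | `|z| = 1].

Definition circle : Type := set_type unit_circle.

HB.instance Definition _ := Topological.copy circle (set_type unit_circle).

Lemma unit_circle1 : (1 : R[i]^o) \in unit_circle.
Proof. by apply/mem_set; rewrite /unit_circle /= normr1. Qed.

HB.instance Definition _ := isPointed.Build circle
  (exist (fun z : R[i]^o => z \in unit_circle) 1 unit_circle1).

Definition circle_val (z : circle) : R[i] := set_val z.

Definition borel_circle := g_sigma_algebraType (@open circle).

End borel_circle.

(* A charge with values in \bar R[i] takes finite values on measurable sets, so
   it is a countably additive R[i]-valued set function. *)
Notation complex_borel_measure R :=
  (charge (borel_circle R) (R[i])).

(* Total variation |mu|: complex.Re only moves the modulus from R[i] to R. *)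
Definition total_variation_measure d (T : measurableType d) (R : realType)
    (mu : charge T (R[i])) (E : set T) : \bar R :=
  ereal_sup [set s | exists F : nat -> set T,
    [/\ forall k, measurable (F k), trivIset setT F, \bigcup_k F k = E &
        s = (\sum_(0 <= k <oo) (complex.Re `|fine (mu (F k))|)%:E)%E]].

Definition support_measure (R : realType) (mu : complex_borel_measure R) :
    set (circle R) :=
  [set z | forall U : set (circle R), open U -> U z ->
    (0 < total_variation_measure mu (U : set (borel_circle R)))%E].

Section charge_parts.
Context d (T : measurableType d) (R : realType) (mu : charge T (R[i])).

Lemma additive_part_sigma_additive (f : {additive R[i] -> R}) :
  (forall z, (`|f z|)%:C <= `|z|) ->
  semi_sigma_additive (fun A : set T => (f (fine (mu A)))%:E).
Proof.
move=> hf F mF tF mUF.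
have muF i : mu (F i) = (fine (mu (F i)))%:E by rewrite fineK ?fin_num_measure.
have muU : mu (\bigcup_n F n) = (fine (mu (\bigcup_n F n)))%:E.
  by rewrite fineK ?fin_num_measure.
have cv := @charge_semi_sigma_additive _ _ _ mu F mF tF mUF.
apply: cvg_EFin; first by apply: nearW => n; rewrite sumEFin.
apply/(@cvgrPdist_lt R R) => e e0.
have e0' : 0 < e%:C :> R[i] by rewrite ltcR.
rewrite muU in cv.
have /cv : nbhs (fine (mu (\bigcup_n F n)))%:E
    [set x : \bar R[i] | `|fine (mu (\bigcup_n F n)) - fine x| < e%:C].
  by exists (e%:C) => //= x.
rewrite /nbhs /=; apply: filterS => n /=.
rewrite sumEFin /= -raddf_sum -raddfB => h.
rewrite -ltcR; apply: le_lt_trans (hf _) _.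
by move: h; under eq_bigr do rewrite muF; rewrite sumEFin.
Qed.

Definition Re_charge (A : set T) : \bar R := (complex.Re (fine (mu A)))%:E.
Definition Im_charge (A : set T) : \bar R := (complex.Im (fine (mu A)))%:E.

Let Re_additive : {additive R[i] -> R} := @complex.Re R : {additive Rcomplex R -> R}.

Let normc_ge_Im (z : R[i]) : (`|complex.Im z|)%:C <= `|z|.
Proof.
have := normc_ge_Re (z * 'i); rewrite ReiNIm !normrN normrM.
by rewrite [X in _ * X]normc_def /= expr0n expr1n add0r sqrtr1 mulr1.
Qed.

Let Re_charge0 : Re_charge set0 = 0%E. Proof. by rewrite /Re_charge charge0. Qed.

Let Re_charge_fin (A : set T) : measurable A -> Re_charge A \is a fin_num.
Proof. by []. Qed.

Let Re_charge_sigma_additive : semi_sigma_additive Re_charge.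
Proof.
exact: (@additive_part_sigma_additive Re_additive (@normc_ge_Re R)).
Qed.

HB.instance Definition _ := isCharge.Build d T R Re_charge
  Re_charge0 Re_charge_fin Re_charge_sigma_additive.

Let Im_additive : {additive R[i] -> R} := @complex.Im R : {additive Rcomplex R -> R}.

Let Im_charge0 : Im_charge set0 = 0%E. Proof. by rewrite /Im_charge charge0. Qed.

Let Im_charge_fin (A : set T) : measurable A -> Im_charge A \is a fin_num.
Proof. by []. Qed.

Let Im_charge_sigma_additive : semi_sigma_additive Im_charge.
Proof.
exact: (@additive_part_sigma_additive Im_additive normc_ge_Im).
Qed.

HB.instance Definition _ := isCharge.Build d T R Im_charge
  Im_charge0 Im_charge_fin Im_charge_sigma_additive.

End charge_parts.

Section charge_integral.
Context d (T : measurableType d) (R : realType).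

Lemma Hahn_decomposition_sig (nu : charge T R) :
  {PN : set T * set T | hahn_decomposition nu PN.1 PN.2}.
Proof.
by apply: cid; have [P [N nuPN]] := Hahn_decomposition nu; exists (P, N).
Qed.

(* integral against a signed measure nu, through the Jordan decomposition of nu,
   which does not depend on the Hahn decomposition from which it is built *)
Definition charge_integral (nu : charge T R) (g : T -> R) : R :=
  let nuPN := svalP (Hahn_decomposition_sig nu) in
  \int[jordan_pos nuPN]_x g x - \int[jordan_neg nuPN]_x g x.

Definition complex_integral (mu : charge T (R[i])) (f : T -> R[i]) : R[i] :=
  (charge_integral (Re_charge mu) (fun x => complex.Re (f x)) -
   charge_integral (Im_charge mu) (fun x => complex.Im (f x))) +i*
  (charge_integral (Re_charge mu) (fun x => complex.Im (f x)) +
   charge_integral (Im_charge mu) (fun x => complex.Re (f x))).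

End charge_integral.

(* A semi-infinite matrix with index types I and J is a function I -> J -> K.
   When the inner index runs over nat, the entries of a product are finitely
   supported sums: \sum_(k \in [set: nat]) is the sum over the support, and is 0
   by convention if the support is infinite, which does not happen below because
   of the triangularity of one of the factors. *)
Section semi_infinite_matrices.
Variable K : fieldType.

Definition smx_mul (I J : Type) (A : I -> nat -> K) (B : nat -> J -> K) :
    I -> J -> K :=
  fun i j => \sum_(k \in [set: nat]) A i k * B k j.

Definition smx1 : nat -> nat -> K := fun i j => (i == j)%:R.

Definition smx_inverse (A A' : nat -> nat -> K) :=
  smx_mul A A' = smx1 /\ smx_mul A' A = smx1.

Definition smx_lower (A : nat -> nat -> K) :=
  forall i j, (i < j)%N -> A i j = 0.

Definition smx_upper (A : nat -> nat -> K) :=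
  forall i j, (j < i)%N -> A i j = 0.

(* M = L^-1 U^-1 *)
Definition LU_factorization (M L U : nat -> nat -> K) :=
  [/\ smx_lower L /\ (forall i, L i i != 0),
      smx_upper U /\ (forall i, U i i != 0)
    & exists L' U', [/\ smx_inverse L L', smx_inverse U U' & M = smx_mul L' U']].

Definition trunc (M : nat -> nat -> K) n : 'M[K]_n :=
  \matrix_(i < n, j < n) M i j.

Definition trunc_rows r (B : nat -> 'I_r -> K) n : 'M[K]_(n, r) :=
  \matrix_(i < n, j < r) B i j.

Definition trunc_cols r (A : 'I_r -> nat -> K) n : 'M[K]_(r, n) :=
  \matrix_(i < r, j < n) A i j.

Definition trunc_vec (v : nat -> K) n : 'cV[K]_n := \col_(i < n) v i.

Definition smx_tr (I J : Type) (A : I -> J -> K) : J -> I -> K := fun j i => A i j.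

Definition block_exponent (k : nat) : int :=
  if odd k then - (k./2.+1)%:Z else (k./2)%:Z.

(* Row i of Z_[r] is row i %% r of the block number i %/ r. *)
Definition Zmx r (z : K) : nat -> 'I_r -> K :=
  fun i j => z ^ block_exponent (i %/ r) * (i %% r == j)%N%:R.

Definition Zcol r (j : 'I_r) (z : K) : nat -> K := fun i => Zmx z i j.

End semi_infinite_matrices.

Section Christoffel_Darboux.
Variables (R : realType) (p q : nat).

Definition moment_matrix (mu : 'M[complex_borel_measure R]_(q, p)) :
    nat -> nat -> R[i] :=
  fun i j => \sum_(a < q) \sum_(b < p)
    complex_integral (mu a b) (fun z : borel_circle R =>
      Zmx (circle_val z) i a * Zmx (circle_val z)^-1 j b).

Definition Bmx (L : nat -> nat -> R[i]) (z : R[i]) : nat -> 'I_q -> R[i] :=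
  smx_mul L (Zmx z).

(* The argument w stands for z^-1 in A(z^-1). *)
Definition Amx (U : nat -> nat -> R[i]) (w : R[i]) : 'I_p -> nat -> R[i] :=
  smx_mul (smx_tr (Zmx w)) U.

Definition CD_kernel (L U : nat -> nat -> R[i]) n (x y : R[i]) : 'M[R[i]]_(p, q) :=
  trunc_cols (Amx U x^-1) n *m trunc_rows (Bmx L y) n.

End Christoffel_Darboux.

(* Main.v *)
(* Triangularity makes truncation multiplicative, so that truncating
   [M = L^-1 U^-1] gives [M^[n] = (L^[n])^-1 (U^[n])^-1], whence
   [(M^[n])^-1 = U^[n] L^[n]], and sandwiching this between the truncations of
   [Z_[p]^T(x^-1)] and [Z_[q](y)] gives the kernel. *)
Require Import Defs.
From HB Require Import structures.
From mathcomp Require Import all_boot all_order all_algebra.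
From mathcomp Require Import all_classical all_reals all_analysis.
From mathcomp Require Import complex.

Set Implicit Arguments.
Unset Strict Implicit.
Unset Printing Implicit Defensive.

Import Order.TTheory GRing.Theory Num.Theory.
Import numFieldNormedType.Exports.

Local Open Scope classical_set_scope.
Local Open Scope ring_scope.
Local Open Scope complex_scope.

Section truncation.
Variable K : fieldType.
Implicit Types L U : nat -> nat -> K.

(** Terms that vanish from [n] on put the support inside [I_n], so the sum over all of [nat] is a
    true finite sum, and its default value 0 for an infinite support never arises. *)
Lemma smx_mul_finE (I J : Type) (A : I -> nat -> K) (B : nat -> J -> K) i j n :
  (forall k, (n <= k)%N -> A i k * B k j = 0) ->
  smx_mul A B i j = \sum_(k < n) A i k * B k j.
Proof.
move=> AB0; rewrite /smx_mul -(fsbig_widen `I_n) //.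
  exact: esym (fsbig_ord _ _ (fun k => A i k * B k j)).
by move=> k [_ /=] /negP; rewrite -leqNgt; exact: AB0.
Qed.

(** Row [i < n] of [L] vanishes from column [n] on, so the sum stops inside the truncation for an
    arbitrary [B]. *)
Lemma smx_mul_lowerE (J : Type) L (B : nat -> J -> K) i j n :
  smx_lower L -> (i < n)%N ->
  smx_mul L B i j = \sum_(k < n) L i k * B k j.
Proof.
move=> lowL ltin; apply: smx_mul_finE => k lenk.
by rewrite lowL ?mul0r// (leq_trans ltin).
Qed.

Lemma smx_mul_upperE (I : Type) (A : I -> nat -> K) U i j n :
  smx_upper U -> (j < n)%N ->
  smx_mul A U i j = \sum_(k < n) A i k * U k j.
Proof.
move=> upU ltjn; apply: smx_mul_finE => k lenk.
by rewrite upU ?mulr0// (leq_trans ltjn).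
Qed.

Lemma trunc1 n : trunc (smx1 K) n = 1%:M.
Proof. by apply/matrixP => i j; rewrite !mxE. Qed.

Lemma trunc_mul_lower L (B : nat -> nat -> K) n :
  smx_lower L -> trunc (smx_mul L B) n = trunc L n *m trunc B n.
Proof.
move=> lowL; apply/matrixP => i j; rewrite !mxE (smx_mul_lowerE _ _ lowL (ltn_ord i)).
by apply: eq_bigr => k _; rewrite !mxE.
Qed.

Lemma trunc_mul_upper (A : nat -> nat -> K) U n :
  smx_upper U -> trunc (smx_mul A U) n = trunc A n *m trunc U n.
Proof.
move=> upU; apply/matrixP => i j; rewrite !mxE (smx_mul_upperE _ _ upU (ltn_ord j)).
by apply: eq_bigr => k _; rewrite !mxE.
Qed.

Lemma trunc_rows_mul_lower r L (B : nat -> 'I_r -> K) n :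
  smx_lower L -> trunc_rows (smx_mul L B) n = trunc L n *m trunc_rows B n.
Proof.
move=> lowL; apply/matrixP => i j; rewrite !mxE (smx_mul_lowerE _ _ lowL (ltn_ord i)).
by apply: eq_bigr => k _; rewrite !mxE.
Qed.

Lemma trunc_cols_mul_upper r (A : 'I_r -> nat -> K) U n :
  smx_upper U -> trunc_cols (smx_mul A U) n = trunc_cols A n *m trunc U n.
Proof.
move=> upU; apply/matrixP => i j; rewrite !mxE (smx_mul_upperE _ _ upU (ltn_ord j)).
by apply: eq_bigr => k _; rewrite !mxE.
Qed.

(** Strong induction on the row, as in forward substitution: in entry [(i, j)] of [L L' = 1] with
    [i < j], the rows of [L'] above [i] contribute 0, which leaves [L i i * L' i j = 0] with a
    nonzero pivot. *)
Lemma smx_lower_inverse L L' :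
  smx_lower L -> (forall i, L i i != 0) -> smx_mul L L' = smx1 K ->
  smx_lower L'.
Proof.
move=> lowL L0 LL' i j; elim/ltn_ind: i => i IHi ltij.
have := congr1 (fun A => A i j) LL'.
rewrite (smx_mul_lowerE _ _ lowL (ltnSn i)) big_ord_recr /= big1 => [|k _]; last first.
  by rewrite IHi ?mulr0// (ltn_trans (ltn_ord k)).
rewrite /smx1 (ltn_eqF ltij) add0r => /eqP.
by rewrite mulf_eq0 (negPf (L0 i)) => /eqP.
Qed.

(* [U U' = 1] would not do: until [U'] is known to be upper triangular, the
   entries of [U U'] may be infinitely supported sums, which are 0 by convention. *)
Lemma smx_upper_inverse U U' :
  smx_upper U -> (forall i, U i i != 0) -> smx_mul U' U = smx1 K ->
  smx_upper U'.
Proof.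
move=> upU U0 U'U i j; elim/ltn_ind: j => j IHj ltji.
have := congr1 (fun A => A i j) U'U.
rewrite (smx_mul_upperE _ _ upU (ltnSn j)) big_ord_recr /= big1 => [|k _]; last first.
  by rewrite IHj ?mul0r// (ltn_trans (ltn_ord k)).
rewrite /smx1 (gtn_eqF ltji) add0r => /eqP.
by rewrite mulf_eq0 (negPf (U0 j)) orbF => /eqP.
Qed.

Lemma LU_factorization_trunc M L U n : LU_factorization M L U ->
  trunc M n *m (trunc U n *m trunc L n) = 1%:M.
Proof.
move=> [[lowL L0] [upU U0] [L' [U' [[LL' _] [_ U'U] ->]]]].
have lowL' := smx_lower_inverse lowL L0 LL'.
(* Lower triangularity of [L'] splits the truncation of [L' U']; that of [U' U = 1] is then
   available because [U] is upper triangular, and the inner factors cancel. *)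
rewrite trunc_mul_lower// mulmxA -(mulmxA (trunc L' n)) -trunc_mul_upper//.
(* What remains has the factors in the order [L' L], while [L] is on the left in the hypothesis
   [L L' = 1]; for the finite square truncations a one-sided inverse is two-sided. *)
rewrite U'U trunc1 mulmx1; apply: mulmx1C.
by rewrite -trunc_mul_lower// LL' trunc1.
Qed.

End truncation.

Theorem theorem2p43 (R : realType) (p q : nat) (hp : (0 < p)%N) (hq : (0 < q)%N)
    (mu : 'M[complex_borel_measure R]_(q, p))
    (hmu : forall (b : 'I_q) (a : 'I_p), infinite_set (support_measure (mu b a)))
    (L U : nat -> nat -> R[i])
    (hLU : LU_factorization (moment_matrix mu) L U)
    (n : nat) (x y : R[i]) (hx : x != 0) (hy : y != 0) :
  let M := trunc (moment_matrix mu) n in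
  let K := @CD_kernel R p q L U n x y in
  [/\ M \in unitmx,
      K = trunc_cols (smx_tr (@Zmx R[i] p x^-1)) n *m invmx M
            *m trunc_rows (@Zmx R[i] q y) n
    & forall (a : 'I_p) (b : 'I_q),
        K a b = ((trunc_vec (Zcol a x^-1) n)^T *m invmx M
                   *m trunc_vec (Zcol b y) n) 0 0].
Proof.
move=> M K.
have MUL : M *m (trunc U n *m trunc L n) = 1%:M := LU_factorization_trunc n hLU.
have [M_unit _] := mulmx1_unit MUL.
have invM : invmx M = trunc U n *m trunc L n.
  by rewrite -[invmx M]mulmx1 -MUL mulKmx.
have [[lowL _] [upU _] _] := hLU.
have KE : K = trunc_cols (smx_tr (@Zmx R[i] p x^-1)) n *m invmx M
            *m trunc_rows (@Zmx R[i] q y) n.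
  rewrite /K /CD_kernel /Amx /Bmx trunc_cols_mul_upper// trunc_rows_mul_lower//.
  by rewrite invM !mulmxA.
split=> // a b; rewrite KE.
have -> : (trunc_vec (Zcol a x^-1) n)^T =
    row a (trunc_cols (smx_tr (@Zmx R[i] p x^-1)) n).
  by apply/matrixP => i j; rewrite !mxE.
have -> : trunc_vec (Zcol b y) n = col b (trunc_rows (@Zmx R[i] q y) n).
  by apply/matrixP => i j; rewrite !mxE.
(* Row [a] and column [b] are taken outside the triple product, so both sides are its entry
   [(a, b)]. *)
by rewrite colE mulmxA -!row_mul -colE [in RHS]mxE [in RHS]mxE.
Qed.
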